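(* Let $X$ be a (real or complex) Banach space. For every $\delta\in(0,2)$, the condition $\Phi_X(\delta)=\sqrt{2\delta}$ is equivalent to the condition $\Phi_X^S(\delta)=\sqrt{2\delta}$.
   Context: For a (real or complex) Banach space $X\neq\{0\}$, $B_X$ and $S_X$ denote its closed unit ball and unit sphere, $X^*$ its topological dual, and $\Pi(X):=\{(x,x^* )\in X\times X^* : \|x\|=\|x^*\|=x^*(x)=1\}$. The Bishop-Phelps-Bollobás modulus $\Phi_X:(0,2)\to[0,\infty)$ is defined as follows: $\Phi_X(\delta)$ is the infimum of those $\varepsilon>0$ such that for every $(x,x^* )\in B_X\times B_{X^*}$ with $\operatorname{Re} x^*(x)>1-\delta$ there is $(y,y^* )\in\Pi(X)$ with $\|x-y\|<\varepsilon$ and $\|x^*-y^*\|<\varepsilon$. The spherical Bishop-Phelps-Bollobás modulus $\Phi_X^S:(0,2)\to[0,\infty)$ is defined in the same way with $B_X\times B_{X^*}$ replaced by $S_X\times S_{X^*}$. *)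

(* Defs.v *)
From HB Require Import structures.
From mathcomp Require Import all_boot all_order all_algebra.
From mathcomp Require Import all_classical all_reals all_analysis.
From mathcomp Require Import complex.

Set Implicit Arguments.
Unset Strict Implicit.
Unset Printing Implicit Defensive.

Import Order.TTheory GRing.Theory Num.Theory.
Import numFieldNormedType.Exports.

Local Open Scope classical_set_scope.
Local Open Scope ring_scope.

(* The real and the complex case are treated at once: [K] is the scalar field
   and [re : K -> R] its real part, to be instantiated by [K = R], [re = idfun]
   or by [K = R[i]], [re = @complex.Re R]. The norm of a [normedModType K] takes
   its values in [K]; as these are real, [re] turns them into elements of [R]. *)
Section bishop_phelps_bollobas.
Context (R : realType) (K : numFieldType) (re : K -> R).
Context (X : completeNormedModType K).

Definition rnorm (x : X) : R := re `|x|.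

(* Only meaningful when [f] is linear and continuous: the [sup] of an unbounded
   set is 0 by convention. Every functional below is required to be continuous. *)
Definition dual_norm (f : X -> K^o) : R :=
  sup [set re `|f x| | x in [set x : X | rnorm x <= 1]].

(* A subset of [X * X^*] is a set of pairs whose second component is a linear
   form, with continuity as an explicit condition. *)
Definition dual_pair : Type := (X * {linear X -> K^o})%type.

Definition unit_balls : set dual_pair :=
  [set p : dual_pair | [/\ continuous p.2, rnorm p.1 <= 1 & dual_norm p.2 <= 1]].

Definition unit_spheres : set dual_pair :=
  [set p : dual_pair | [/\ continuous p.2, rnorm p.1 = 1 & dual_norm p.2 = 1]].

Definition Pi_set : set dual_pair :=
  [set p : dual_pair | [/\ continuous p.2, rnorm p.1 = 1, dual_norm p.2 = 1
                        & p.2 p.1 = 1]].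

Definition bpb_admissible (D : set dual_pair) (delta : R) : set R :=
  [set eps | 0 < eps /\
    forall p : dual_pair, D p -> 1 - delta < re (p.2 p.1) ->
      exists q : dual_pair,
        [/\ Pi_set q, rnorm (p.1 - q.1) < eps & dual_norm (p.2 \- q.2) < eps]].

(* When [X] is nonzero, [Pi_set] is nonempty by Hahn-Banach, so that the two
   sets below contain every [eps > 2]; they are bounded below by 0. Hence these are
   genuine infima. *)
Definition bpb_modulus (delta : R) : R := inf (bpb_admissible unit_balls delta).

Definition spherical_bpb_modulus (delta : R) : R :=
  inf (bpb_admissible unit_spheres delta).

End bishop_phelps_bollobas.

(* Main.v *)
From HB Require Import structures.
Require Import Defs.
From mathcomp Require Import all_boot all_order all_algebra.
From mathcomp Require Import all_classical all_reals all_analysis.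
From mathcomp Require Import complex.
From mathcomp Require Import ring lra.

(* Write s = sqrt (2 delta). One always has Phi^S <= Phi <= s, the second
   inequality being the sharp Bishop-Phelps-Bollobas theorem, so only the
   implication from Phi = s to Phi^S = s remains, i.e. that Phi^S < s forces
   Phi < s. Pairs whose norms are both close to 1 are perturbed to pairs in the
   spheres. For the other pairs, the Bishop-Phelps-Bollobas argument
   (Ekeland's principle on a ball of radius r <= 1, then Hahn-Banach) gives a
   supporting pair at distance at most e as soon as
   2 (r |f| - f x) <= (e - (1 - |f|)) (e - (1 - r)), and as s < 2 some e < s
   does the job uniformly if |f| or |x| is bounded away from 1.
   A complex space is treated as a real one through f |-> Re f. *)

Set Implicit Arguments.
Unset Strict Implicit.
Unset Printing Implicit Defensive.

Import Order.TTheory GRing.Theory Num.Theory.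
Import numFieldNormedType.Exports.
Local Open Scope classical_set_scope.
Local Open Scope ring_scope.

(** * The Hahn-Banach theorem *)

Section hahn_banach.
Context (R : realType) (V : lmodType R).
Implicit Types (q p : V -> R) (C : set (V * R)).

Definition sublinear q :=
  (forall x y, q (x + y) <= q x + q y) /\
  (forall r x, 0 <= r -> q (r *: x) <= r * q x).

Lemma sublinear0 q : sublinear q -> q 0 = 0.
Proof.
move=> [qD qZ]; apply/eqP; rewrite eq_le; apply/andP; split.
  by rewrite -(scale0r 0) (le_trans (qZ _ _ _))// mul0r.
by have := qD 0 0; rewrite addr0; lra.
Qed.

Lemma sublinear_ge q x : sublinear q -> - q (- x) <= q x.
Proof.
by move=> qs; have := qs.1 x (- x); rewrite subrr sublinear0//; lra.
Qed.

(* A pair [(a, c)] of [C] encodes the constraint [c <= h a] on a linear form [h]: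
   it is satisfied by every [h] below [cone_inf q C]. *)
Definition cone_inf q C x : R := inf [set q (x + u.1) - u.2 | u in C].

Section cone_inf.
Context (q : V -> R) (C : set (V * R)).
Hypotheses (qs : sublinear q) (C0 : C (0, 0)).
Hypothesis CD : forall u v, C u -> C v -> C (u.1 + v.1, u.2 + v.2).
Hypothesis CZ : forall r u, 0 < r -> C u -> C (r *: u.1, r * u.2).
Hypothesis Cq : forall u, C u -> u.2 <= q u.1.

(** Makes the infimum genuine: [q a <= q (x + a) + q (- x)] and [c <= q a] for every constraint
    [(a, c)]. *)
Let cone_inf_lb x : lbound [set q (x + u.1) - u.2 | u in C] (- q (- x)).
Proof.
move=> _ [u Cu <-]; have := qs.1 (x + u.1) (- x); rewrite addrC addKr.
by have := Cq Cu; lra.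
Qed.

Lemma cone_inf_le x u : C u -> cone_inf q C x <= q (x + u.1) - u.2.
Proof.
by move=> Cu; apply: ge_inf; [exists (- q (- x))|exists u].
Qed.

Lemma cone_inf_ge x c : (forall u, C u -> c <= q (x + u.1) - u.2) ->
  c <= cone_inf q C x.
Proof.
move=> cC; apply: lb_le_inf; first by exists (q (x + 0) - 0), (0, 0).
by move=> _ [u Cu <-]; exact: cC.
Qed.

Lemma cone_inf_le_base x : cone_inf q C x <= q x.
Proof. by have := cone_inf_le x C0; rewrite addr0 subr0. Qed.

Lemma cone_inf_opp u : C u -> cone_inf q C (- u.1) <= - u.2.
Proof.
by move=> /(cone_inf_le (- u.1)); rewrite addNr sublinear0// sub0r.
Qed.

Lemma sublinear_cone_inf : sublinear (cone_inf q C).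
Proof.
split=> [x y|r x].
  rewrite -lerBlDr; apply: cone_inf_ge => u Cu.
  rewrite lerBlDr -lerBlDl; apply: cone_inf_ge => v Cv.
  rewrite lerBlDl.
  have := cone_inf_le (x + y) (CD Cu Cv) => /=.
  have := qs.1 (x + u.1) (y + v.1); rewrite addrACA; lra.
rewrite le_eqVlt => /predU1P[<-|r0].
  by rewrite scale0r mul0r (le_trans (cone_inf_le_base _))// sublinear0.
rewrite -ler_pdivrMl//; apply: cone_inf_ge => u Cu.
rewrite ler_pdivrMl// (le_trans (cone_inf_le _ (CZ r0 Cu)))//= -scalerDr mulrBr.
by rewrite lerD2r; apply: qs.2; exact: ltW.
Qed.

End cone_inf.

(* For fixed [y], the infimum over [t >= 0] of [q (x + t *: y) - t * q y] is
   sublinear in [x] and below [q], hence equal to [q]; at [x = - y] this yields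
   [q (- y) <= - q y]. *)
Lemma minimal_sublinear_scalar q : sublinear q ->
  (forall p, sublinear p -> (forall x, p x <= q x) -> p = q) -> scalar q.
Proof.
move=> qs qmin.
have qN y : q (- y) = - q y.
  apply/eqP; rewrite eq_le; apply/andP; split; last first.
    by have := sublinear_ge y qs; lra.
  pose C := [set u : V * R | exists2 t, 0 <= t & u = (t *: y, t * q y)].
  have C0 : C (0, 0) by exists 0; rewrite ?scale0r ?mul0r.
  have CD u v : C u -> C v -> C (u.1 + v.1, u.2 + v.2).
    move=> [t t0 ->] [t' t'0 ->]; exists (t + t'); first exact: addr_ge0.
    by rewrite scalerDl mulrDl.
  have CZ r u : 0 < r -> C u -> C (r *: u.1, r * u.2).
    move=> r0 [t t0 ->]; exists (r * t); first by rewrite mulr_ge0// ltW.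
    by rewrite /= scalerA mulrA.
  have Cq u : C u -> u.2 <= q u.1.
    move=> [t]; rewrite le_eqVlt => /predU1P[<-|t0] -> /=.
      by rewrite scale0r mul0r sublinear0.
    rewrite -ler_pdivlMl//.
    have := qs.2 t^-1 (t *: y); rewrite scalerK ?gt_eqF//; apply.
    by rewrite invr_ge0 ltW.
  rewrite -[in leLHS](qmin _ (sublinear_cone_inf qs C0 CD CZ Cq)); last first.
    by move=> x; exact: cone_inf_le_base.
  have /(cone_inf_opp qs Cq) : C (y, q y) by exists 1; rewrite ?scale1r ?mul1r.
  by [].
have qZ r x : 0 <= r -> q (r *: x) = r * q x.
  move=> r0; apply/eqP; rewrite eq_le qs.2//=.
  by have := qs.2 r (- x) r0; rewrite scalerN !qN mulrN lerN2.
have qD x y : q (x + y) = q x + q y.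
  apply/eqP; rewrite eq_le qs.1//=.
  by have := qs.1 (- x) (- y); rewrite -opprD !qN -opprD lerN2.
move=> r x y; rewrite qD; congr (_ + _); have [/qZ ->//|r0] := leP 0 r.
by rewrite -[r]opprK scaleNr qN qZ ?oppr_ge0 ?ltW// !mulNr.
Qed.

(** By Zorn's lemma there is a minimal sublinear functional below [p], and minimal ones are linear.
    Chains are bounded by their pointwise infimum. *)
Lemma hahn_banach p : sublinear p ->
  exists2 h : V -> R, scalar h & forall x, h x <= p x.
Proof.
move=> ps; pose T := {q : V -> R | sublinear q /\ forall x, q x <= p x}.
pose below (s t : T) := `[< forall x, sval t x <= sval s x >].
have below_refl t : below t t by apply/asboolP.
have below_trans r s t : below r s -> below s t -> below r t.
  move=> /asboolP rs /asboolP st; apply/asboolP => x.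
  exact: le_trans (st x) (rs x).
have below_anti s t : below s t -> below t s -> s = t.
  case: s t => [s ?] [t ?] /asboolP st /asboolP ts.
  by apply/eq_exist/funext => x; apply/eqP; rewrite eq_le st ts.
have chain (A : set T) : total_on A below ->
    exists t, forall s, A s -> below s t.
  move=> Atot; have [[a Aa]|A0] := pselect (A !=set0); last first.
    exists (exist _ p (conj ps (fun=> lexx _))) => s As.
    by case: A0; exists s.
  pose S x := [set sval s x | s in A].
  have Slb x : lbound (S x) (- p (- x)).
    move=> _ [s As <-]; have [ss sp] := svalP s.
    by rewrite (le_trans _ (sublinear_ge _ ss))// lerN2.
  have infS_le x s : A s -> inf (S x) <= sval s x.
    by move=> As; apply: ge_inf; [exists (- p (- x))|exists s].
  have infS_ge x c : (forall s, A s -> c <= sval s x) -> c <= inf (S x).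
    move=> cS; apply: lb_le_inf; first by exists (sval a x), a.
    by move=> _ [s As <-]; exact: cS.
  have infS : sublinear (fun x => inf (S x)) /\ forall x, inf (S x) <= p x.
    split; last first.
      by move=> x; exact: le_trans (infS_le _ _ Aa) ((svalP a).2 x).
    split=> [x y|r x].
      rewrite -lerBlDr; apply: (infS_ge) => s As.
      rewrite lerBlDr -lerBlDl; apply: (infS_ge) => t At.
      rewrite lerBlDl.
      (* The smaller of [s] and [t] serves at [x] and at [y] simultaneously. *)
      have [/asboolP st|/asboolP ts] := Atot _ _ As At.
        rewrite (le_trans (infS_le _ _ At))// (le_trans ((svalP t).1.1 _ _))//.
        exact: lerD (st x) (lexx _).
      rewrite (le_trans (infS_le _ _ As))// (le_trans ((svalP s).1.1 _ _))//.
      exact: lerD (lexx _) (ts y).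
    rewrite le_eqVlt => /predU1P[<-|r0].
      rewrite scale0r mul0r (le_trans (infS_le _ _ Aa))// sublinear0//.
      exact: (svalP a).1.
    rewrite -ler_pdivrMl//; apply: (infS_ge) => s As.
    rewrite ler_pdivrMl// (le_trans (infS_le _ _ As))//.
    by apply: (svalP s).1.2; exact: ltW.
  exists (exist _ (fun x => inf (S x)) infS) => s As.
  by apply/asboolP => x; exact: infS_le.
have [[q [qs qp]] qmax] := Zorn below_refl below_trans below_anti chain.
exists q => //; apply: minimal_sublinear_scalar => // q' q's q'q.
have q'p x : q' x <= p x by exact: le_trans (q'q x) (qp x).
have := qmax (exist _ q' (conj q's q'p)) => /(_ _)/(congr1 sval)/=; apply.
exact/asboolP.
Qed.

(** A linear form below [cone_inf q C] takes at [- a] a value at most [- c], which is the constraint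
    [(a, c)]. *)
Lemma hahn_banach_cone q C : sublinear q -> C (0, 0) ->
  (forall u v, C u -> C v -> C (u.1 + v.1, u.2 + v.2)) ->
  (forall r u, 0 < r -> C u -> C (r *: u.1, r * u.2)) ->
  (forall u, C u -> u.2 <= q u.1) ->
  exists h : V -> R, [/\ scalar h, forall x, h x <= q x &
    forall u, C u -> u.2 <= h u.1].
Proof.
move=> qs C0 CD CZ Cq.
have [h hl hq] := hahn_banach (sublinear_cone_inf qs C0 CD CZ Cq).
exists h; split => // [x|u Cu].
  exact: le_trans (hq x) (cone_inf_le_base _ C0 Cq x).
have hN : h (- u.1) = - h u.1.
  have h0 : h 0 = 0 by have := hl 1 0 0; rewrite scale1r addr0; lra.
  by have := hl (-1) u.1 0; rewrite scaleN1r !addr0 h0; lra.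
by rewrite -lerN2 -hN (le_trans (hq _))// (cone_inf_opp qs Cq).
Qed.

End hahn_banach.

(** * Supporting pairs in a complete real normed space *)

Section real_normed_space.
Context (R : realType) (V : lmodType R) (N : V -> R).
Hypothesis ND : forall x y, N (x + y) <= N x + N y.
Hypothesis NZ : forall r x, N (r *: x) = `|r| * N x.
Implicit Types (f g h : V -> R) (x y w z : V).

(** One-sided, which suffices for linear [f]: replacing [x] by [- x] bounds the absolute value. *)
Definition bounded_by f (c : R) := forall x, f x <= c * N x.

Definition has_norm f (c : R) :=
  bounded_by f c /\ forall c', bounded_by f c' -> c <= c'.

Lemma seminorm0 : N 0 = 0.
Proof. by rewrite -(scale0r 0) NZ normr0 mul0r. Qed.

Lemma seminormN x : N (- x) = N x.
Proof. by rewrite -scaleN1r NZ normrN1 mul1r. Qed.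

Lemma seminorm_distC x y : N (x - y) = N (y - x).
Proof. by rewrite -seminormN opprB. Qed.

Lemma seminorm_ge0 x : 0 <= N x.
Proof. by have := ND x (- x); rewrite subrr seminorm0 seminormN; lra. Qed.

Lemma seminormZ_ge0 r x : 0 <= r -> N (r *: x) = r * N x.
Proof. by move=> r0; rewrite NZ ger0_norm. Qed.

Lemma seminorm_dist_triangle x y w : N (x - y) <= N (x - w) + N (w - y).
Proof. by rewrite -[x - y](subrKA w). Qed.

Lemma sublinear_seminorm k : 0 <= k -> sublinear (fun x => k * N x).
Proof.
move=> k0; split=> [x y|r x r0]; first by rewrite -mulrDr ler_wpM2l.
by rewrite seminormZ_ge0// mulrCA.
Qed.

Lemma scalarD f x y : scalar f -> f (x + y) = f x + f y.
Proof. by move=> /(_ 1 x y); rewrite scale1r mul1r. Qed.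

Lemma scalar0 f : scalar f -> f 0 = 0.
Proof. by move=> fl; have := scalarD 0 0 fl; rewrite addr0; lra. Qed.

Lemma scalarZ f r x : scalar f -> f (r *: x) = r * f x.
Proof. by move=> fl; rewrite -[r *: x]addr0 fl scalar0// addr0. Qed.

Lemma scalarN f x : scalar f -> f (- x) = - f x.
Proof. by move=> fl; rewrite -scaleN1r scalarZ// mulN1r. Qed.

Lemma scalarB f x y : scalar f -> f (x - y) = f x - f y.
Proof. by move=> fl; rewrite scalarD// scalarN. Qed.

Lemma scalar_sub f g : scalar f -> scalar g -> scalar (f \- g).
Proof. by move=> fl gl r x y; rewrite /= fl gl; ring. Qed.

Lemma scalar_mul f c : scalar f -> scalar (fun x => c * f x).
Proof. by move=> fl r x y; rewrite fl; ring. Qed.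

Lemma bounded_by_opp f c x : scalar f -> bounded_by f c -> - f x <= c * N x.
Proof. by move=> fl /(_ (- x)); rewrite scalarN// seminormN. Qed.

Lemma bounded_by_ge f c d : c <= d -> bounded_by f c -> bounded_by f d.
Proof.
by move=> cd fc x; rewrite (le_trans (fc x))// ler_wpM2r// seminorm_ge0.
Qed.

Lemma has_norm_inj f c d : has_norm f c -> has_norm f d -> c = d.
Proof.
by move=> [fc cmin] [fd dmin]; apply/eqP; rewrite eq_le cmin// dmin.
Qed.

Lemma bounded_by_add f g c d : bounded_by f c -> bounded_by g d ->
  bounded_by (f \+ g) (c + d).
Proof. by move=> fc gd x; rewrite mulrDl lerD. Qed.

Lemma bounded_by_sub f g c d : scalar g -> bounded_by f c -> bounded_by g d ->
  bounded_by (f \- g) (c + d).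
Proof.
by move=> gl fc gd x; rewrite mulrDl lerD//; exact: bounded_by_opp.
Qed.

Lemma bounded_by_mul f a c : scalar f -> bounded_by f c ->
  bounded_by (fun x => a * f x) (`|a| * c).
Proof.
move=> fl fc x; have [a0|a0] := leP 0 a.
  by rewrite ger0_norm// -mulrA ler_wpM2l.
have na0 : 0 < - a by rewrite oppr_gt0.
have := ler_wpM2l (ltW na0) (bounded_by_opp x fl fc).
by rewrite ltr0_norm//; lra.
Qed.

Section has_norm.
Hypothesis V1 : exists z, N z = 1.

Lemma bounded_by_ge0 f c : scalar f -> bounded_by f c -> 0 <= c.
Proof.
have [z z1] := V1; move=> fl fc; have := fc z; have := bounded_by_opp z fl fc.
by rewrite z1; lra.
Qed.

Lemma has_norm_exists f c : scalar f -> bounded_by f c ->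
  exists2 d, d <= c & has_norm f d.
Proof.
move=> fl fc; pose S := [set c | bounded_by f c].
have S0 : lbound S 0 by move=> d; exact: bounded_by_ge0.
have Slb : has_lbound S by exists 0.
exists (inf S); first exact: ge_inf.
split=> [x|d fd]; last exact: ge_inf.
have [Nx0|Nx0] := eqVneq (N x) 0.
  by have := fc x; rewrite Nx0 !mulr0.
have Nx : 0 < N x by rewrite lt_neqAle eq_sym Nx0 seminorm_ge0.
rewrite -ler_pdivrMr//; apply: lb_le_inf; first by exists c.
by move=> d /(_ x); rewrite ler_pdivrMr.
Qed.

End has_norm.

(** * Ekeland's principle and supporting pairs *)

Hypothesis Ncomplete : forall u : nat -> V,
  (forall e, 0 < e -> exists n0, forall m n, (n0 <= m)%N -> (n0 <= n)%N ->
    N (u m - u n) <= e) ->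
  exists l, forall e, 0 < e -> exists n0, forall n, (n0 <= n)%N ->
    N (l - u n) <= e.

(** Order the ball by letting [w] follow [u] when [k * N (w - u) <= f w - f u]. A sequence starting
    at [x], each term of which nearly maximizes [f] among the followers of the previous one, is
    Cauchy, and its limit is maximal. *)
Lemma ekeland_ball f c k r x : scalar f -> bounded_by f c -> 0 < k ->
  N x <= r -> exists y, [/\ N y <= r, k * N (x - y) <= f y - f x &
    forall w, N w <= r -> f w - f y <= k * N (w - y)].
Proof.
move=> fl fc k0 xr.
have c_ge0 : 0 <= `|c| by [].
have fc' : bounded_by f `|c| := bounded_by_ge (ler_norm c) fc.
pose S u := [set w | N w <= r /\ k * N (w - u) <= f w - f u].
have S_trans u v w : S u v -> S v w -> S u w.
  move=> [_ vu] [wr wv]; split => //.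
  by have := ler_wpM2l (ltW k0) (seminorm_dist_triangle w u v); lra.
have Sf u v : S u v -> f u <= f v.
  by move=> [_ uv]; have := mulr_ge0 (ltW k0) (seminorm_ge0 (v - u)); lra.
have S_refl u : N u <= r -> S u u.
  by move=> ur; rewrite /S/= !subrr seminorm0 mulr0.
have [eps eps_gt0 small] : exists2 eps : nat -> R, forall n, 0 < eps n &
    forall e, 0 < e -> exists n, eps n < e.
  exists (fun n => n.+1%:R^-1) => [n|e e0]; first by rewrite invr_gt0.
  exists (Num.truncn e^-1).
  by rewrite invf_plt ?posrE// truncnS_gt.
(* The ball condition sits under the quantifier on [w], so that [choice] gives a total function. *)
have next (p : nat * V) : exists w, N p.2 <= r ->
    S p.2 w /\ forall v, S p.2 v -> f v <= f w + eps p.1.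
  case: p => n u /=; have [ur|?] := pselect (N u <= r); last by exists u.
  have fS : has_sup [set f v | v in S u].
    split; first by exists (f u), u => //; exact: S_refl.
    exists (`|c| * r) => _ [v [vr _] <-].
    by rewrite (le_trans (fc' v))// ler_wpM2l.
  have [_ [w Sw <-] fw] := sup_adherent (eps_gt0 n) fS.
  exists w => _; split => // v Sv.
  have /(ub_le_sup fS.2) : [set f v | v in S u] (f v) by exists v.
  by move: fw; lra.
have [F FP] := choice next.
pose u := fix u n := if n is m.+1 then F (m, u m) else x.
have ur n : N (u n) <= r.
  by elim: n => [//|n IHn]; exact: (FP (n, u n) IHn).1.1.
have uS n m : (n <= m)%N -> S (u n) (u m).
  elim: m => [|m IHm]; first by rewrite leqn0 => /eqP ->; exact: S_refl.
  rewrite leq_eqVlt => /predU1P[->|/IHm]; first exact: S_refl.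
  by move/S_trans; apply; exact: (FP (m, u m) (ur m)).1.
have fu n v : S (u n) v -> f v <= f (u n.+1) + eps n.
  by move=> Sv; exact: (FP (n, u n) (ur n)).2.
have [l ul] : exists l, forall e, 0 < e -> exists n0, forall n, (n0 <= n)%N ->
    N (l - u n) <= e.
  apply: Ncomplete => e e0.
  have [n ne] := small (k * (e / 2)) ltac:(by rewrite mulr_gt0// divr_gt0).
  have near m : (n.+1 <= m)%N -> N (u m - u n.+1) <= e / 2.
    move=> nm; rewrite -(ler_pM2l k0); have [_ kN] := uS _ _ nm.
    by have := fu n _ (uS _ _ (ltnW nm)); lra.
  exists n.+1 => m m' nm nm'.
  have := seminorm_dist_triangle (u m) (u m') (u n.+1); have := near _ nm.
  by have := near _ nm'; rewrite seminorm_distC; lra.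
(* Followers of [u n] form a closed set. In the tolerance [e / (k + |c|)], [k] accounts for the norm
   term and [|c|] for [f]. *)
have Sl n : S (u n) l.
  split; apply/ler_addgt0Pr => e e0.
    have [m /(_ _ (leqnn m)) ml] := ul e e0.
    by have := ND (l - u m) (u m); rewrite subrK; have := ur m; lra.
  have kc0 : 0 < k + `|c| by rewrite ltr_wpDr.
  have [m /(_ _ (leq_maxr n m))] := ul (e / (k + `|c|)) (divr_gt0 e0 kc0).
  set m' := maxn n m; rewrite ler_pdivlMr// => ml.
  have [_ nm] := uS _ _ (leq_maxl n m : (n <= m')%N).
  have := fc' (u m' - l); rewrite scalarB// seminorm_distC.
  by have := ler_wpM2l (ltW k0) (seminorm_dist_triangle l (u n) (u m')); lra.
exists l; split; first exact: (Sl 0%N).1.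
  by rewrite seminorm_distC; exact: (Sl 0%N).2.
(* A strict improvement [w] on [l] would follow every [u n], so that [f w <= f l + eps n] for all
   [n], hence [f w <= f l]. *)
move=> w wr; rewrite leNgt; apply/negP => lw.
have Sw n : S (u n) w.
  by apply: S_trans (Sl n) _; split => //; exact: ltW.
have : f w - f l <= 0.
  apply/ler_addgt0Pr => e /small[n ne].
  by have := fu n _ (Sw n); have := Sf _ _ (Sl n.+1); lra.
by have := mulr_ge0 (ltW k0) (seminorm_ge0 (w - l)); lra.
Qed.

Definition supports h y := [/\ scalar h, N y = 1, bounded_by h 1 & h y = 1].

(** Hahn-Banach with the constraints [t <= h (t *: x)] on the ray through [x]: [1 <= h x] meets
    [h x <= N x = 1]. *)
Lemma norm1_inhabited x : N x = 1 -> exists h, supports h x.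
Proof.
move=> x1; pose C := [set u : V * R | exists2 t, 0 <= t & u = (t *: x, t)].
have [|||u [t t0 ->]|h [hl hN hC]] :=
  @hahn_banach_cone _ _ (fun x => 1 * N x) C (sublinear_seminorm ler01).
- by exists 0; rewrite ?scale0r.
- move=> u v [t t0 ->] [t' t'0 ->]; exists (t + t'); first exact: addr_ge0.
  by rewrite scalerDl.
- move=> r u r0 [t t0 ->]; exists (r * t); first by rewrite mulr_ge0// ltW.
  by rewrite /= scalerA.
- by rewrite mul1r seminormZ_ge0// x1 mulr1.
exists h; split => //; apply/eqP; rewrite eq_le.
have := hN x; rewrite x1 mulr1 => -> /=.
by have /hC : C (x, 1) by exists 1; rewrite ?scale1r.
Qed.

(* Ekeland's principle yields a point [y0] of the ball of radius [r] that nearly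
   maximizes [f]; then [f] splits as [g + h] with [h] of norm at most [k] and
   [g] maximal at [y0] on that ball, and [y0 / r], [g / |g|] are the answer. *)
Lemma bishop_phelps f x th r k : scalar f -> has_norm f th ->
  0 < k < th -> th <= 1 -> 0 < r <= 1 -> N x <= r ->
  exists y g, [/\ supports g y, N (x - y) <= 1 - r + (r * th - f x) / k &
    bounded_by (f \- g) (2 * k + 1 - th)].
Proof.
move=> fl [fth thmin] /andP[k0 kth] th1 /andP[r0 r1] xr.
have [y0 [y0r xy0 fy0]] := ekeland_ball fl fth k0 xr.
(* For [t > 0] the directions are the [t *: (w - y0)] with [w] in the ball. The constraint [f <= h]
   there says that [f \- h] is maximal at [y0]; its compatibility with [k * N] is the maximality of
   [y0] in Ekeland's principle. *)
pose C := [set u : V * R | exists t, [/\ 0 <= t, N (u.1 + t *: y0) <= t * r &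
  u.2 = f u.1]].
have [|||[a c]|h [hl hN hC]] :=
  @hahn_banach_cone _ _ _ C (sublinear_seminorm (ltW k0)).
- by exists 0; split => //=; rewrite ?scale0r ?addr0 ?seminorm0 ?mul0r ?scalar0.
- move=> u v [t [t0 ut ->]] [t' [t'0 vt' ->]]; exists (t + t'); split => /=.
  + exact: addr_ge0.
  + by rewrite scalerDl addrACA mulrDl (le_trans (ND _ _))// lerD.
  + by rewrite scalarD.
- move=> s u s0 [t [t0 ut ->]]; exists (s * t); split => /=.
  + by rewrite mulr_ge0// ltW.
  + by rewrite -scalerA -scalerDr -mulrA (seminormZ_ge0 _ (ltW s0)) ler_pM2l.
  + by rewrite scalarZ.
- move=> /= [t /= [+ + ->]]; rewrite le_eqVlt => /predU1P[<-|t0].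
    rewrite scale0r addr0 mul0r => a0.
    have {a0}a0 : N a = 0 by apply/eqP; rewrite eq_le a0 seminorm_ge0.
    by have := fth a; rewrite a0 !mulr0.
  have tV0 : 0 <= t^-1 by rewrite invr_ge0 ltW.
  move=> at0; have := fy0 (t^-1 *: (a + t *: y0)).
  rewrite seminormZ_ge0// ler_pdivrMl// => /(_ at0).
  rewrite scalerDr scalerK ?gt_eqF// (scalarD _ _ fl) !addrK scalarZ//.
  by rewrite seminormZ_ge0// mulrCA ler_pM2l// invr_gt0.
pose g := f \- h; have gl : scalar g by exact: scalar_sub.
have gy0 w : N w <= r -> g w <= g y0.
  move=> wr; rewrite -subr_ge0 -scalarB// /g/= subr_ge0.
  suff /hC/= : C (w - y0, f (w - y0)).
    by rewrite -[y0 - w]opprB !scalarN// lerN2.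
  by exists 1; rewrite scale1r subrK mul1r.
(* This is the norm of [g]; since [f] is [g + h], it lies between [th - k] and [th + k]. *)
pose c := g y0 / r.
have gc : bounded_by g c.
  move=> w; have [Nw0|Nw0] := eqVneq (N w) 0.
    rewrite Nw0 mulr0 /g/= subr_le0.
    have := fth w; have := hN (- w).
    by rewrite scalarN// seminormN Nw0 !mulr0; lra.
  have Nw : 0 < N w by rewrite lt_neqAle eq_sym Nw0 seminorm_ge0.
  have := gy0 ((r / N w) *: w).
  rewrite seminormZ_ge0 ?divfK// ?divr_ge0 ?(ltW r0) ?(ltW Nw)//.
  move=> /(_ (lexx _)); rewrite scalarZ// -ler_pdivlMl ?divr_gt0//.
  by congr (_ <= _); rewrite /c; field; rewrite !gt_eqF.
have hk : bounded_by h k by [].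
have gtk : bounded_by g (th + k) by exact: bounded_by_sub.
have thck : th <= c + k.
  by apply: thmin => w; have := gc w; have := hk w; rewrite /g/=; lra.
have c0 : 0 < c by lra.
have cgy0 : g y0 = c * r by rewrite /c divfK// gt_eqF.
have Ny0 : N y0 = r.
  apply/eqP; rewrite eq_le y0r -(ler_pM2l c0) -cgy0; exact: gc.
have c_le : c <= th + k by rewrite -(ler_pM2r r0) -cgy0 -Ny0; exact: gtk.
exists (r^-1 *: y0), (fun w => c^-1 * g w); split.
- split.
  + exact: scalar_mul.
  + by rewrite seminormZ_ge0 ?invr_ge0 ?(ltW r0)// Ny0 mulVf// gt_eqF.
  + by move=> w; rewrite mul1r ler_pdivrMl.
  + by rewrite scalarZ// cgy0; field; rewrite !gt_eqF.
(* Triangle inequality through [y0]: normalizing it costs [1 - r], and [k * N (x - y0) <= f y0 - f x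
   <= r * th - f x]. *)
- have -> : 1 - r = N (y0 - r^-1 *: y0).
    rewrite -{1}[y0]scale1r -scalerBl NZ Ny0 ler0_norm.
      by rewrite opprB mulrBl mul1r mulVf// gt_eqF.
    by rewrite subr_le0 invf_ge1.
  rewrite (le_trans (seminorm_dist_triangle _ _ y0))// addrC lerD2l.
  rewrite ler_pdivlMr// mulrC.
  rewrite (le_trans xy0)// lerD2r mulrC -Ny0; exact: fth.
(* The two summands have bounds [k] and [|c - 1|], and the latter is at most [k + (1 - th)]. *)
- have fE : f \- (fun w => c^-1 * g w) = h \+ (fun w => (1 - c^-1) * g w).
    by apply/funext => w; rewrite /g/=; ring.
  rewrite fE; apply: (@bounded_by_ge _ (k + `|1 - c^-1| * c)); last first.
    by apply: bounded_by_add => //; exact: bounded_by_mul.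
  rewrite -{2}(gtr0_norm c0) -normrM mulrBl mul1r mulVf ?gt_eqF//.
  have : `|c - 1| <= k + (1 - th) by rewrite ler_norml; apply/andP; split; lra.
  by lra.
Qed.

(** * Perturbation of pairs with norms close to 1 into the spheres *)

Lemma has_norm_approx f th e : scalar f -> has_norm f th -> 0 < e ->
  exists2 z, N z <= 1 & th - e < f z.
Proof.
move=> fl [fth thmin] e0; apply: contrapT => noz.
suff /thmin : bounded_by f (th - e) by lra.
move=> x; have [Nx0|Nx0] := eqVneq (N x) 0.
  by have := fth x; rewrite Nx0 !mulr0.
have Nx : 0 < N x by rewrite lt_neqAle eq_sym Nx0 seminorm_ge0.
rewrite leNgt; apply/negP => fx; apply: noz; exists ((N x)^-1 *: x).
  by rewrite seminormZ_ge0 ?invr_ge0 ?seminorm_ge0// mulVf.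
by rewrite scalarZ// mulrC ltr_pdivlMr.
Qed.

Lemma has_norm_normalize f th : scalar f -> has_norm f th -> 0 < th ->
  has_norm (fun x => th^-1 * f x) 1.
Proof.
move=> fl [fth thmin] th0; split=> [x|c fc].
  by rewrite mul1r ler_pdivrMl.
rewrite -(ler_pM2l th0) mulr1; apply: thmin => x.
by rewrite -mulrA -ler_pdivrMl.
Qed.

(** Here [a] and [b] are the values of the normalized form at [x] and [z], and [n] is the norm of
    [(1 - t) *: x + t *: z]. If [delta <= 1], already [1 - delta < a]. Otherwise [1 - delta] is
    negative, so the lower bound on [n] matters, and the gain from [b] absorbs the losses in
    [eta]. *)
Lemma normalized_convex_gt (delta t eta th a b n : R) :
  0 < delta < 2 -> 0 < t <= 8^-1 -> 0 < eta <= delta ->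
  eta <= (2 - delta) * t / 4 -> 1 - eta <= th <= 1 ->
  1 - delta < th * a -> 1 - eta < b -> 1 - eta - 2 * t <= n <= 1 ->
  (1 - delta) * n < (1 - t) * a + t * b.
Proof.
move=> /andP[d0 d2] /andP[t0 t1] /andP[eta0 etad] etat /andP[th0 th1] tha bge.
move=> /andP[n0 n1]; have eta_small : eta < 16^-1 by nra.
have t1' : 0 < 1 - t by lra.
have tb : t * (1 - eta) < t * b by rewrite ltr_pM2l.
have [d1|d1] := leP delta 1.
  have a0 : 1 - delta < a by nra.
  have ta : (1 - t) * (1 - delta) < (1 - t) * a by rewrite ltr_pM2l.
  have : (1 - delta) * n <= 1 - delta by rewrite ler_piMr// subr_ge0.
  have : t * eta <= t * delta by rewrite ler_pM2l.
  by lra.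
(* [1 + 2 * eta] bounds the inverse of [1 - eta], hence that of [th], from above. *)
have a0 : - (delta - 1) * (1 + 2 * eta) < a.
  rewrite ltNge; apply/negP => ale.
  have a_le0 : a <= 0 by nra.
  have tha' : th * a <= (1 - eta) * a by rewrite ler_wnM2r.
  have : (1 - eta) * a <= (1 - eta) * (- (delta - 1) * (1 + 2 * eta)).
    by rewrite ler_pM2l//; lra.
  have : 0 <= (delta - 1) * (eta * (1 - 2 * eta)).
    by rewrite !mulr_ge0//; lra.
  by lra.
have ta : (1 - t) * (- (delta - 1) * (1 + 2 * eta)) < (1 - t) * a.
  by rewrite ltr_pM2l.
have nd : (1 - delta) * n <= (1 - delta) * (1 - eta - 2 * t).
  by rewrite ler_wnM2l//; lra.
have dt : 0 <= (delta - 1) * (t * eta) by rewrite !mulr_ge0//; lra.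
have de : (delta - 1) * eta <= eta by rewrite ler_piMl//; lra.
have te : t * eta <= eta by rewrite ler_piMl//; lra.
by lra.
Qed.

(* If [1 < delta], normalizing [x] and [f] may break [1 - delta < f x]. This is
   repaired by first moving [x] slightly towards a point [z] at which the
   normalized form is almost 1; the gain is of order [t * (2 - delta)]. *)
Lemma near_unit_spheres f x th (delta t eta : R) : scalar f -> has_norm f th ->
  0 < delta < 2 -> 0 < t <= 8^-1 -> 0 < eta <= delta ->
  eta <= (2 - delta) * t / 4 ->
  1 - eta <= th <= 1 -> 1 - eta <= N x <= 1 -> 1 - delta < f x ->
  exists x' f', [/\ N x' = 1, scalar f', has_norm f' 1, 1 - delta < f' x' &
    N (x - x') <= 5 * t /\ bounded_by (f \- f') (5 * t)].
Proof.
move=> fl fth dB tB etaB etat thB /andP[x0 x1] fx.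
have [d0 d2] := andP dB; have [t0 t1] := andP tB; have [eta0 etad] := andP etaB.
have [th0 th1] := andP thB; have eta_t : eta <= t by nra.
have th_gt0 : 0 < th by lra.
have f'1 := has_norm_normalize fl fth th_gt0.
pose f' w := th^-1 * f w; have f'l : scalar f' by exact: scalar_mul.
have [z z1 fz] := has_norm_approx f'l f'1 eta0.
pose w := (1 - t) *: x + t *: z.
have t1' : 0 <= 1 - t by lra.
have w1 : N w <= 1.
  rewrite (le_trans (ND _ _))// !seminormZ_ge0 ?(ltW t0)//.
  by have := ler_wpM2l t1' x1; have := ler_wpM2l (ltW t0) z1; lra.
have xw : N (x - w) <= 2 * t.
  have -> : x - w = t *: (x - z).
    by rewrite /w scalerBl scale1r -addrA opprD addNKr opprD opprK -scalerBr.
  rewrite seminormZ_ge0 ?(ltW t0)// mulrC ler_pM2r//.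
  by rewrite (le_trans (ND _ _))// seminormN; lra.
have w0 : 1 - eta - 2 * t <= N w.
  by have := ND (x - w) w; rewrite subrK; lra.
have Nw : 0 < N w by lra.
exists ((N w)^-1 *: w), f'; split => //.
- by rewrite seminormZ_ge0 ?invr_ge0 ?seminorm_ge0// mulVf// gt_eqF.
- rewrite (scalarZ _ _ f'l) mulrC ltr_pdivlMr// {2}/w.
  rewrite (scalarD _ _ f'l) !(scalarZ _ _ f'l).
  apply: (@normalized_convex_gt _ t eta th) => //; last by rewrite w0 w1.
  by rewrite /f' mulrA mulfV ?gt_eqF// mul1r.
split.
  (* Moving [x] to [w] costs [2 * t], normalizing [w] costs at most [eta + 2 * t], and
     [eta <= t]. *)
  rewrite (le_trans (seminorm_dist_triangle _ _ w))//.
  have -> : w - (N w)^-1 *: w = (1 - (N w)^-1) *: w by rewrite scalerBl scale1r.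
  rewrite NZ ler0_norm ?subr_le0 ?invf_ge1// opprB mulrBl mul1r mulVf ?gt_eqF//.
  by lra.
have fE : f \- f' = fun v => (1 - th^-1) * f v.
  by apply/funext => v; rewrite /f'/=; ring.
rewrite fE; apply: (@bounded_by_ge _ (`|1 - th^-1| * th)); last first.
  by apply: bounded_by_mul => //; exact: fth.1.
rewrite -{2}(gtr0_norm th_gt0) -normrM mulrBl mul1r mulVf ?gt_eqF//.
by rewrite ler0_norm; lra.
Qed.

(** * Sharp Bishop-Phelps-Bollobas estimates and comparison of the moduli *)

Hypothesis V1 : exists z, N z = 1.

Lemma supports_near x : N x <= 1 ->
  exists y g, supports g y /\ N (x - y) <= 1.
Proof.
move=> x1; have [Nx0|Nx0] := eqVneq (N x) 0.
  have [z z1] := V1; have [g gz] := norm1_inhabited z1.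
  exists z, g; split => //.
  by rewrite (le_trans (ND _ _))// seminormN Nx0 z1 add0r.
have Nx : 0 < N x by rewrite lt_neqAle eq_sym Nx0 seminorm_ge0.
have y1 : N ((N x)^-1 *: x) = 1.
  by rewrite seminormZ_ge0 ?invr_ge0 ?seminorm_ge0// mulVf.
have [g gy] := norm1_inhabited y1; exists ((N x)^-1 *: x), g; split => //.
have -> : x - (N x)^-1 *: x = (1 - (N x)^-1) *: x by rewrite scalerBl scale1r.
rewrite NZ ler0_norm ?subr_le0 ?invf_ge1// opprB mulrBl mul1r mulVf//.
by lra.
Qed.

Lemma bishop_phelps_bollobas f x th r s : scalar f -> has_norm f th ->
  th <= 1 -> 0 < r <= 1 -> N x <= r -> 1 - th < s ->
  2 * (r * th - f x) <= (s - (1 - th)) * (s - (1 - r)) ->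
  exists y g, [/\ supports g y, N (x - y) <= s & bounded_by (f \- g) s].
Proof.
move=> fl fth th1 /andP[r0 r1] xr ths sB.
(* Chosen so that the bound [2 * k + 1 - th] on the forms equals [s]. *)
pose k := (s - (1 - th)) / 2; have k0 : 0 < k by rewrite /k; lra.
have kE : (s - (1 - th)) = 2 * k by rewrite /k; lra.
have [kth|thk] := ltP k th.
  have [|||y [g [gy xy fg]]] := @bishop_phelps f x th r k fl fth _ th1.
  - by rewrite k0.
  - by rewrite r0.
  - by [].
  exists y, g; split => //; last by apply: bounded_by_ge fg; lra.
  by rewrite (le_trans xy)// -lerBrDl ler_pdivrMr//; rewrite kE in sB; lra.
(* Now [th <= k] means [th + 1 <= s], so every supporting form is close enough to [f], and distance
   1 is allowed for the points. *)
have [y [g [gy xy]]] := supports_near (le_trans xr r1).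
exists y, g; split => //.
  have := bounded_by_ge0 V1 fl fth.1; lra.
have [gl _ g1 _] := gy.
by apply: bounded_by_ge (bounded_by_sub gl fth.1 g1); lra.
Qed.

(** A strict bound on the norm that does not refer to its value. *)
Definition norm_lt f (e : R) := exists2 c, c < e & bounded_by f c.

Definition ball_pair x f := N x <= 1 /\ bounded_by f 1.

Definition sphere_pair x f := N x = 1 /\ has_norm f 1.

Definition admissible (D : V -> (V -> R) -> Prop) (delta : R) : set R :=
  [set eps : R | 0 < eps /\ forall x f, scalar f -> D x f -> 1 - delta < f x ->
    exists y g, [/\ supports g y, N (x - y) < eps & norm_lt (f \- g) eps]].

Lemma admissible_ball_sphere delta :
  admissible ball_pair delta `<=` admissible sphere_pair delta.
Proof.
move=> e [e0 eB]; split => // x f fl [x1 [f1 _]].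
by apply: eB => //; split => //; rewrite x1.
Qed.

Lemma ball_pair_norm delta x f : scalar f -> ball_pair x f -> 1 - delta < f x ->
  exists th, [/\ has_norm f th, th <= 1, f x <= th & 1 - th < delta].
Proof.
move=> fl [x1 f1] fx; have [th th1 fth] := has_norm_exists V1 fl f1.
have th0 := bounded_by_ge0 V1 fl fth.1.
have := fth.1 x; have := ler_piMr th0 x1 => ? ?.
by exists th; split => //; lra.
Qed.

(** With radius 1 the estimate holds for [s] itself: [2 * (th - f x)] is below
    [s ^+ 2 - 2 * (1 - th)], and [s < 2]. *)
Lemma admissible_ball_gt delta s eps :
  0 < delta -> 0 < s < 2 -> s ^+ 2 = 2 * delta ->
  s < eps -> admissible ball_pair delta eps.
Proof.
move=> d0 /andP[s0 s2] ss seps; split=> [|x f fl xf fx]; first by lra.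
have [th [fth th1 fxth thd]] := ball_pair_norm fl xf fx.
have [||||y [g [gy xy fg]]] :=
  @bishop_phelps_bollobas f x th 1 s fl fth th1.
- by rewrite ltr01 lexx.
- exact: xf.1.
- by nra.
- by nra.
exists y, g; split => //; first exact: le_lt_trans seps.
by exists s.
Qed.

(* A pair whose norms are both within [eta] of 1 is close to a pair in the
   product of the spheres. Any other pair is already closer to a supporting pair
   than [s], by [bishop_phelps_bollobas] on the unit ball if [f] is short and on
   the ball of radius [1 - eta] if [x] is. *)
Lemma admissible_sphere_ball delta s eps :
  0 < delta -> 0 < s < 2 -> s ^+ 2 = 2 * delta ->
  admissible sphere_pair delta eps -> eps < s ->
  exists2 eps', admissible ball_pair delta eps' & eps' < s.
Proof.
move=> d0 /andP[s0 s2] ss [eps0 epsS] eps_s; have d2 : delta < 2 by nra.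
have ds : delta < s by nra.
(* Passing to the spheres costs [5 * t], which must fit between [eps] and [s]. *)
pose t := (s - eps) / 16; have t0 : 0 < t by rewrite /t; lra.
have t1 : t <= 8^-1 by rewrite /t; lra.
have epst : eps + 5 * t < s by rewrite /t; lra.
have [eta [eta0 etad eta2 etat]] : exists eta,
    [/\ 0 < eta, eta <= delta, eta <= 2 - s & eta <= (2 - delta) * t / 4].
  exists (Num.min (Num.min delta (2 - s)) ((2 - delta) * t / 4)).
  split; rewrite ?lt_min ?ge_min ?lexx ?orbT//.
  by rewrite d0 subr_gt0 s2 divr_gt0// mulr_gt0// subr_gt0.
have eta1 : eta < 1 by nra.
(* The distance for the remaining pairs: [s'] is so close to [s] that the loss [s ^+ 2 - s' ^+ 2] is
   covered by the gain [eta * (2 - s)], and [delta <= s'] ensures [1 - th < s']. *)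
have [s' [s's ds' s'B]] : exists s',
    [/\ s' < s, delta <= s' & s ^+ 2 - s' ^+ 2 <= eta * (2 - s)].
  pose e := eta * (2 - s) / 4.
  have e0 : 0 < e by rewrite divr_gt0// mulr_gt0// subr_gt0.
  have [le|ge] := leP (s - e) delta.
    exists delta; split => //.
    have : (s - delta) * (s + delta) <= e * 4 by apply: ler_pM; lra.
    by rewrite /e; lra.
  exists (s - e); split; [lra|lra|].
  have : e * (s + (s - e)) <= e * 4 by rewrite ler_pM2l//; lra.
  by rewrite /e; lra.
exists (Num.max ((s + s') / 2) (eps + 5 * t)); last first.
  by rewrite gt_max epst andbT; lra.
set eps' := Num.max _ _.
have s'eps' : s' < eps' by rewrite lt_max; apply/orP; left; lra.
have epseps' : eps + 5 * t <= eps' by rewrite le_max lexx orbT.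
have close x f : (exists y g,
    [/\ supports g y, N (x - y) <= s' & bounded_by (f \- g) s']) ->
  exists y g, [/\ supports g y, N (x - y) < eps' & norm_lt (f \- g) eps'].
  move=> [y [g [gy xy fg]]]; exists y, g; split => //.
    exact: le_lt_trans s'eps'.
  by exists s'.
split=> [|x f fl xf fx]; first by lra.
have [th [fth th1 fxth thd]] := ball_pair_norm fl xf fx.
have [th_eta|th_eta] := ltP th (1 - eta).
  apply: close; apply: (@bishop_phelps_bollobas f x th 1 s') => //.
  - by rewrite ltr01 lexx.
  - exact: xf.1.
  - by lra.
  - have : eta * (2 - s) <= (1 - th) * (2 - s') by apply: ler_pM; lra.
    by lra.
(* The smaller radius gains [eta * (2 - s')]; the rest, a multiple of [2 - s' - eta], is nonnegative
   because [eta <= 2 - s]. *)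
have [x_eta|x_eta] := ltP (N x) (1 - eta).
  apply: close; apply: (@bishop_phelps_bollobas f x th (1 - eta) s') => //.
  - by apply/andP; split; lra.
  - exact: ltW.
  - by lra.
  - have : eta * (2 - s) <= eta * (2 - s') by rewrite ler_pM2l//; lra.
    have : 0 <= (1 - th) * (2 - s' - eta) by rewrite mulr_ge0//; lra.
    by lra.
have [|||||x' [f' [x'1 f'l f'1 f'x' [xx' ff']]]] :=
  @near_unit_spheres f x th delta t eta fl fth _ _ _ etat _ _ fx.
- by rewrite d0 d2.
- by rewrite t0 t1.
- by rewrite eta0 etad.
- by rewrite th_eta th1.
- by rewrite x_eta xf.1.
have [y [g [gy xy [c c_eps f'g]]]] := epsS x' f' f'l (conj x'1 f'1) f'x'.
exists y, g; split => //.
  by have := seminorm_dist_triangle x y x'; lra.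
exists (5 * t + c); first by lra.
have -> : f \- g = (f \- f') \+ (f' \- g) by apply/funext => w /=; ring.
exact: bounded_by_add.
Qed.

Lemma inf_admissible_ball_sphere delta s :
  0 < delta -> 0 < s < 2 -> s ^+ 2 = 2 * delta ->
  inf (admissible ball_pair delta) = s <->
  inf (admissible sphere_pair delta) = s.
Proof.
move=> d0 sB ss; have [s0 s2] := andP sB.
have ball_gt eps := @admissible_ball_gt delta s eps d0 sB ss.
have lb D : has_lbound (admissible D delta) by exists 0 => e [/ltW].
have B0 : admissible ball_pair delta !=set0.
  by exists (s + 1); apply: (ball_gt); lra.
have inf_le :
    inf (admissible sphere_pair delta) <= inf (admissible ball_pair delta).
  apply: lb_le_inf => // e eB; apply: ge_inf => //.
  exact: admissible_ball_sphere.
have inf_s : inf (admissible ball_pair delta) <= s.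
  apply/ler_addgt0Pr => e e0; apply: ge_inf => //.
  by apply: (ball_gt); lra.
split=> [Bs|Ss]; last by apply/eqP; rewrite eq_le inf_s -Ss inf_le.
apply/eqP; rewrite eq_le (le_trans inf_le inf_s)/=.
apply: lb_le_inf => [|e eS].
  by have [e /admissible_ball_sphere] := B0; exists e.
rewrite leNgt; apply/negP => /(admissible_sphere_ball d0 sB ss eS)[e' e'B].
by rewrite ltNge -Bs => /negP; apply; exact: ge_inf.
Qed.

End real_normed_space.

(** * Restriction of scalars *)

(** An alias carrying [inR], so that the real module structure can be declared beside the one over
    [K]. *)
Definition restrict_scalars (R : realType) (K : numFieldType)
  (inR : {rmorphism R -> K}) (X : lmodType K) : Type := X.

Section restrict_scalars.
Context (R : realType) (K : numFieldType) (inR : {rmorphism R -> K}).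
Context (X : lmodType K).
Local Notation V := (restrict_scalars inR X).

HB.instance Definition _ := GRing.Zmodule.copy V X.

Let scale (r : R) (x : V) : V := inR r *: (x : X).

Let scaleA a b x : scale a (scale b x) = scale (a * b) x.
Proof. by rewrite /scale scalerA rmorphM. Qed.

Let scale1 : left_id 1 scale.
Proof. by move=> x; rewrite /scale rmorph1 scale1r. Qed.

Let scaleDr : right_distributive scale +%R.
Proof. by move=> r x y; exact: scalerDr. Qed.

Let scaleDl x : {morph scale^~ x : a b / a + b}.
Proof. by move=> a b; rewrite /scale rmorphD; exact: scalerDl. Qed.

HB.instance Definition _ :=
  GRing.Zmodule_isLmodule.Build R V scaleA scale1 scaleDr scaleDl.

Lemma restrict_scalarsD (x y : V) : x + y = (x : X) + (y : X) :> X.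
Proof. by []. Qed.

Lemma restrict_scalarsZ r (x : V) : r *: x = inR r *: (x : X) :> X.
Proof. by []. Qed.

End restrict_scalars.

(** * Transfer of the moduli to the underlying real space *)

Section transfer.
Context (R : realType) (K : numFieldType).
Context (re : K -> R) (inR : {rmorphism R -> K}).
Hypothesis re1 : re 1 = 1.
Hypothesis reD : forall x y, re (x + y) = re x + re y.
Hypothesis reM : forall r z, re (inR r * z) = r * re z.
Hypothesis inR_le : forall r t, (inR r <= inR t) = (r <= t).
Hypothesis ge0_inR : forall z : K, 0 <= z -> inR (re z) = z.
Hypothesis re_le_norm : forall z, re z <= re `|z|.
Hypothesis re_eq_norm : forall z, re z = re `|z| -> z = `|z|.
Context (X : completeNormedModType K).
Local Notation V := (restrict_scalars inR X).
Hypothesis re_lift : forall g : V -> R, scalar g ->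
  exists f : {linear X -> K^o}, forall x, re (f x) = g x.
Hypothesis X1 : exists x : X, x != 0.

Local Notation N := (@rnorm R K re X : V -> R).
Implicit Types (f : X -> K^o) (g : V -> R).

Let reK r : re (inR r) = r.
Proof. by rewrite -[inR r]mulr1 reM re1 mulr1. Qed.

Let inR_lt r t : (inR r < inR t) = (r < t).
Proof. by rewrite !lt_neqAle inR_le (inj_eq (fmorph_inj inR)). Qed.

Let norm_inR (Y : normedModType K) (y : Y) : inR (re `|y|) = `|y|.
Proof. by rewrite ge0_inR. Qed.

Let inR_pos (e : K) : 0 < e -> inR (re e) = e /\ 0 < re e.
Proof.
move=> e0; have eE := ge0_inR (ltW e0).
by split=> //; rewrite -inR_lt eE rmorph0.
Qed.

Lemma rnormD (x y : V) : N (x + y) <= N x + N y.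
Proof. by rewrite -inR_le rmorphD !norm_inR ler_normD. Qed.

Lemma rnormZ r (x : V) : N (r *: x) = `|r| * N x.
Proof.
rewrite /rnorm restrict_scalarsZ normrZ -reM; congr (re (_ * _)).
have [r0|r0] := leP 0 r.
  by rewrite !ger0_norm// -(rmorph0 inR) inR_le.
by rewrite ltr0_norm -?(rmorph0 inR) ?inR_lt// ltr0_norm// rmorphN.
Qed.

Lemma rnorm_complete (u : nat -> V) :
  (forall e, 0 < e -> exists n0, forall m n, (n0 <= m)%N -> (n0 <= n)%N ->
    N (u m - u n) <= e) ->
  exists l, forall e, 0 < e -> exists n0, forall n, (n0 <= n)%N ->
    N (l - u n) <= e.
Proof.
move=> uC; have : cvg ((u : nat -> X) @ \oo).
  apply/cauchy_cvgP/cauchy_exP => e e0; have [eE re0] := inR_pos e0.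
  have [n0 un0] := uC (re e / 2) (divr_gt0 re0 (ltr0n _ 2)).
  exists (u n0 : X); exists n0 => // n /= n0n.
  rewrite -ball_normE/= -eE -norm_inR inR_lt.
  by have := un0 _ _ (leqnn _) n0n; rewrite /rnorm; lra.
move=> /cvgrPdist_le ul; exists (lim ((u : nat -> X) @ \oo)) => e e0.
have [|n0 _ un0] := ul (inR e); first by rewrite -(rmorph0 inR) inR_lt.
exists n0 => n n0n; rewrite -inR_le norm_inR; exact: un0.
Qed.

Lemma rnorm_unit : exists z : V, N z = 1.
Proof.
have [x x0] := X1; exists (`|x|^-1 *: x : X).
by rewrite /rnorm normrZ normfV normr_id mulVf ?normr_eq0.
Qed.

Local Notation bounded_by := (bounded_by (@rnorm R K re X : V -> R)).
Local Notation has_norm := (has_norm (@rnorm R K re X : V -> R)).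

Lemma scalar_re f : linear f -> scalar (re \o f : V -> R).
Proof.
move=> fl r x y /=; rewrite restrict_scalarsZ.
by rewrite (fl (inR r) x y) reD reM.
Qed.

(** Multiplying [x] by the unit scalar [|f x| / f x] keeps its norm and turns the value of [f] into
    [|f x|], which equals its real part. *)
Lemma bounded_by_norm f c x : linear f -> bounded_by (re \o f) c ->
  re `|f x| <= c * N x.
Proof.
move=> fl fc.
have f0 : f 0 = 0 by have := fl (-1) 0 0; rewrite scaler0 addr0 scaleN1r addNr.
have fZ a y : f (a *: y) = a * f y by have := fl a y 0; rewrite !addr0 f0 addr0.
have [fx0|fx0] := eqVneq (f x) 0.
  have := fc x; have := fc (- x : V) => /=; rewrite fx0.
  have -> : f (- x) = 0 by rewrite -scaleN1r fZ fx0 mulr0.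
  rewrite normr0.
  have -> : re 0 = 0 by rewrite -(rmorph0 inR) reK.
  by [].
have := fc (`|f x| / f x *: x : X).
rewrite /= fZ divfK// => /le_trans; apply.
by rewrite /rnorm normrZ normf_div normr_id divff ?normr_eq0// mul1r.
Qed.

Lemma continuous_bounded_by (f : {linear X -> K^o}) :
  continuous f <-> exists c, bounded_by (re \o f) c.
Proof.
split=> [/linear_bounded_continuous/linear_boundedP|[c fc]].
  move=> /pinfty_ex_gt0[M M0 fM]; have [ME _] := inR_pos M0.
  exists (re M) => x /=; rewrite (le_trans (re_le_norm _))// -inR_le norm_inR.
  by rewrite rmorphM ME norm_inR; exact: fM.
apply/linear_bounded_continuous/linear_boundedP; exists (inR c); split.
  by rewrite realE -(rmorph0 inR) !inR_le -realE num_real.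
move=> r cr x; have := bounded_by_norm x (linearP f) fc.
rewrite -inR_le rmorphM !norm_inR => /le_trans; apply.
by rewrite ler_wpM2r// ltW.
Qed.

Lemma has_norm_dual_norm f c : linear f -> bounded_by (re \o f) c ->
  has_norm (re \o f) (dual_norm re f).
Proof.
move=> fl fc; rewrite /dual_norm; set S := image _ _.
have f_le d x : bounded_by (re \o f) d -> rnorm re x <= 1 -> re `|f x| <= d.
  move=> fd x1; rewrite (le_trans (bounded_by_norm x fl fd))//.
  by rewrite ler_piMr// (bounded_by_ge0 rnormZ rnorm_unit (scalar_re fl) fd).
have Sub : has_ubound S by exists c => _ [x x1 <-]; exact: f_le.
split=> [x|d fd]; last first.
  apply: ge_sup; last by move=> _ [x x1 <-]; exact: f_le.
  exists (re `|f 0|), 0 => //=.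
  by rewrite /rnorm normr0 -(rmorph0 inR) reK ler01.
have [Nx0|Nx0] := eqVneq (N x) 0.
  by have := fc x; rewrite Nx0 !mulr0.
have Nx : 0 < N x by rewrite lt_neqAle eq_sym Nx0 (seminorm_ge0 rnormD rnormZ).
have y1 : N ((N x)^-1 *: x) <= 1.
  by rewrite (seminormZ_ge0 rnormZ) ?invr_ge0 ?(ltW Nx)// mulVf.
rewrite -ler_pdivrMr// mulrC -(scalarZ _ _ (scalar_re fl)).
rewrite (le_trans (re_le_norm _))//; apply: ub_le_sup => //.
by exists ((N x)^-1 *: x).
Qed.

(** A form and its real part have the same norm, and every real form is a real part by [re_lift];
    hence supporting pairs and distances correspond. *)
Lemma bpb_admissible_restrict_scalars (D : set (dual_pair X))
    (D' : V -> (V -> R) -> Prop) delta :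
  (forall p, D p <-> continuous p.2 /\ D' p.1 (re \o p.2)) ->
  (forall x g, D' x g -> exists c, bounded_by g c) ->
  bpb_admissible re D delta = admissible N D' delta.
Proof.
move=> DD' D'b.
have sub_lin (f h : {linear X -> K^o}) : linear (f \- h).
  by move=> a u v /=; rewrite !linearP scalerDr addrACA.
have re_sub (f h : {linear X -> K^o}) :
    re \o (f \- h) = (re \o f) \- (re \o h) :> (V -> R).
  apply/funext => z /=.
  by rewrite -[- h z]mulN1r -(rmorph1 inR) -rmorphN reD reM mulN1r.
apply/seteqP; split=> e [e0 eD]; split=> //.
  move=> x g gl xg gx; have [f fg] := re_lift gl.
  have {}fg : re \o f = g by apply/funext => z; exact: fg.
  have [c fc] := D'b _ _ xg; rewrite -fg in xg gx fc.
  have fC : continuous f by apply/continuous_bounded_by; exists c.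
  have [[y h] [[/= hC y1 h1 hy] xy fh]] :=
    eD (x, f) ((DD' (x, f)).2 (conj fC xg)) gx.
  have [d hd] := (continuous_bounded_by h).1 hC.
  have h_norm := has_norm_dual_norm (linearP h) hd; rewrite h1 in h_norm.
  have fhb : bounded_by (re \o (f \- h)) (c + d).
    by rewrite re_sub; apply: (bounded_by_sub rnormZ (scalar_re (linearP h))).
  exists y, (re \o h); split=> //.
    split=> //=; last by rewrite hy re1.
      exact: scalar_re (linearP h).
    exact: h_norm.1.
  exists (dual_norm re (f \- h)) => //; rewrite -fg -re_sub.
  exact: (has_norm_dual_norm (sub_lin f h) fhb).1.
move=> [x f] /DD'[/= fC xf] fx.
have [y [g [[gl y1 g1 gy] xy [c ce fgc]]]] :=
  eD x _ (scalar_re (linearP f)) xf fx.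
have [h hg] := re_lift gl.
have {}hg : re \o h = g by apply/funext => z; exact: hg.
rewrite -hg in gl g1 gy fgc.
exists (y, h); split=> //=; last first.
  rewrite -re_sub in fgc.
  exact: le_lt_trans ((has_norm_dual_norm (sub_lin f h) fgc).2 _ fgc) ce.
split=> //=.
- by apply/continuous_bounded_by; exists 1.
- apply: has_norm_inj (has_norm_dual_norm (linearP h) g1) _.
  by split=> // c' /(_ y); rewrite gy y1 mulr1.
(* Real part 1 and modulus at most 1 force [h y] to be 1. *)
- have hy1 : re `|h y| = 1.
    apply/eqP; rewrite eq_le -{2}gy re_le_norm andbT.
    by have := bounded_by_norm y (linearP h) g1; rewrite y1 mulr1.
  have -> : h y = `|h y| by apply: re_eq_norm; rewrite hy1.
  by rewrite -norm_inR hy1 rmorph1.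
Qed.

Theorem bpb_modulus_spherical delta : 0 < delta < 2 ->
  bpb_modulus re X delta = Num.sqrt (2 * delta) <->
  spherical_bpb_modulus re X delta = Num.sqrt (2 * delta).
Proof.
move=> /andP[d0 d2]; rewrite /bpb_modulus /spherical_bpb_modulus.
rewrite (@bpb_admissible_restrict_scalars _ (ball_pair N)); last 2 first.
- move=> [x f]; split=> [[/= fC x1 f1]|[/= fC [x1 f1]]].
    have [c fc] := (continuous_bounded_by f).1 fC.
    split=> //; split=> //.
    apply: (bounded_by_ge rnormD rnormZ f1).
    exact: (has_norm_dual_norm (linearP f) fc).1.
  by split=> //=; exact: (has_norm_dual_norm (linearP f) f1).2 _ f1.
- by move=> x g [_ g1]; exists 1.
rewrite (@bpb_admissible_restrict_scalars _ (sphere_pair N)); last 2 first.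
- move=> [x f]; split=> [[/= fC x1 f1]|[/= fC [x1 f1]]].
    have [c fc] := (continuous_bounded_by f).1 fC.
    split=> //; split=> //; rewrite -f1.
    exact: has_norm_dual_norm (linearP f) fc.
  split=> //=.
  exact: has_norm_inj (has_norm_dual_norm (linearP f) f1.1) f1.
- by move=> x g [_ [g1 _]]; exists 1.
have dd : 0 <= 2 * delta by lra.
have ss := sqr_sqrtr dd; have s_ge0 := sqrtr_ge0 (2 * delta).
apply: (inf_admissible_ball_sphere rnormD rnormZ rnorm_complete rnorm_unit) => //.
by move: ss s_ge0; set s := Num.sqrt _ => ? ?; apply/andP; split; nra.
Qed.

End transfer.

(** * Lifting real forms over the real and the complex field *)

Lemma linear_exists (K : numFieldType) (X : lmodType K) (f : X -> K^o) :
  linear f -> exists F : {linear X -> K^o}, forall x, F x = f x.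
Proof.
move=> fl; pose L := GRing.isLinear.Build K X K^o *:%R f fl.
by pose F : {linear X -> K^o} := HB.pack f L; exists F.
Qed.

Lemma real_lift (R : realType) (X : completeNormedModType R)
    (g : restrict_scalars (idfun : {rmorphism R -> R}) X -> R) :
  scalar g -> exists f : {linear X -> R^o}, forall x, idfun (f x) = g x.
Proof. by move=> gl; exact: (@linear_exists R X g). Qed.

(** The classical formula [f x = g x - i g (i x)] gives a complex linear form with real part [g]. *)
Lemma complex_lift (R : realType) (X : completeNormedModType R[i])
    (g : restrict_scalars (real_complex R) X -> R) :
  scalar g -> exists f : {linear X -> R[i]^o}, forall x, complex.Re (f x) = g x.
Proof.
move=> gl; pose f (x : X) : R[i]^o := Complex (g x) (- g ('i%C *: x)).
suff /linear_exists[F FE] : linear f by exists F => x; rewrite FE.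
have gD (u v : X) : g (u + v) = g u + g v.
  by rewrite -(scalarD _ _ gl) (@restrict_scalarsD _ _ (real_complex R)).
have gZ a (x : X) :
    g (a *: x) = complex.Re a * g x + complex.Im a * g ('i%C *: x).
  rewrite -!(scalarZ _ _ gl) !restrict_scalarsZ -gD scalerA mulrC -scalerDl.
  by rewrite -complexE.
move=> a x y; rewrite /f.
have -> : g (a *: x + y) =
    complex.Re a * g x + complex.Im a * g ('i%C *: x) + g y.
  by rewrite (gD (a *: x) y) (gZ a x).
have -> : g ('i%C *: (a *: x + y)) =
    complex.Re a * g ('i%C *: x) - complex.Im a * g x + g ('i%C *: y).
  rewrite (scalerDr 'i%C (a *: x) y) (gD ('i%C *: (a *: x)) ('i%C *: y)).
  rewrite (scalerA 'i%C a x) (mulrC 'i%C a) (gZ (a * 'i%C) x) ReiNIm ImiRe.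
  by rewrite mulNr (addrC (- _)).
case: a => p q; apply/eqP.
rewrite eq_complex /=; apply/andP; split; apply/eqP; ring.
Qed.

Theorem proposition3p8 (R : realType) :
  (forall (X : completeNormedModType R), (exists x : X, x != 0) ->
    forall delta : R, 0 < delta < 2 ->
      (bpb_modulus idfun X delta = Num.sqrt (2 * delta) <->
       spherical_bpb_modulus idfun X delta = Num.sqrt (2 * delta))) /\
  (forall (X : completeNormedModType (complex R)), (exists x : X, x != 0) ->
    forall delta : R, 0 < delta < 2 ->
      (bpb_modulus (@complex.Re R) X delta = Num.sqrt (2 * delta) <->
       spherical_bpb_modulus (@complex.Re R) X delta
         = Num.sqrt (2 * delta))).
Proof.
split=> X X1 delta dB.
  apply: (@bpb_modulus_spherical R R idfun idfun) => //.
  - by move=> z; exact: ler_norm.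
  - exact: real_lift.
apply: (@bpb_modulus_spherical R R[i] (@complex.Re R) (real_complex R)) => //.
- by case=> [a b] [c d].
- by move=> r [a b] /=; rewrite mul0r subr0.
- exact: lecR.
- by move=> z z0; exact: RRe_real (ger0_real z0).
- move=> z; rewrite (le_trans (ler_norm _))// -lecR RRe_real ?normr_real//.
  exact: normc_ge_Re.
(* If [a] equals the modulus of [a + i b], then [b] vanishes. *)
- move=> [a b]; rewrite normc_def /= => ab.
  have b0 : b ^+ 2 = 0.
    have := sqr_sqrtr (addr_ge0 (sqr_ge0 a) (sqr_ge0 b)).
    by rewrite -ab; lra.
  by move/eqP: b0; rewrite sqrf_eq0 -ab => /eqP ->.
- exact: complex_lift.
Qed.
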